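(* Let $0<\alpha<1$, let $q$ be defined by $\frac1q=1-\alpha$, and let $\omega:\mathbb{Z}\to(0,\infty)$ be a discrete weight. Then $\omega\in\mathcal{A}(1,q)$ if and only if the discrete fractional maximal operator $M_\alpha$ is bounded from $l^1_\omega$ to $l^{q,weak}_{\omega^q}$, i.e., if and only if there exists a constant $C>0$ such that for every sequence $x\in l^1_\omega$ and every $\lambda>0$, $$\Bigg(\sum_{\{k\in\mathbb{Z}:\,M_\alpha x(k)>\lambda\}}\omega(k)^q\Bigg)^{1/q}\le \frac{C}{\lambda}\sum_{k\in\mathbb{Z}}|x(k)|\,\omega(k).$$
   Context: For $m\in\mathbb{Z}$ and $N\in\mathbb{N}=\{0,1,2,\dots\}$, let $S_{m,N}:=\{k\in\mathbb{Z}:|k-m|\le N\}$, with cardinality $|S_{m,N}|=2N+1$. A discrete weight is a function $\omega:\mathbb{Z}\to(0,\infty)$. Weight class: $\omega\in\mathcal{A}(1,q)$ means $$\sup_{m\in\mathbb{Z},\,N\in\mathbb{N}}\Bigg(\frac1{|S_{m,N}|}\sum_{k\in S_{m,N}}\omega(k)^q\Bigg)^{1/q}\Bigg(\sup_{k\in S_{m,N}}\frac1{\omega(k)}\Bigg)<\infty.$$ Operator: for a real sequence $x=\{x(k)\}_{k\in\mathbb{Z}}$ and $0\le\alpha<1$, $M_\alpha x(m):=\sup_{N\in\mathbb{N}}\frac{1}{|S_{m,N}|^{1-\alpha}}\sum_{k\in S_{m,N}}|x(k)|$ for $m\in\mathbb{Z}$. Spaces: $l^1_\omega$ is the set of real sequences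 $x$ with $\|x\|_{l^1_\omega}=\sum_{k\in\mathbb{Z}}|x(k)|\omega(k)<\infty$. For a weight $v$, $l^{q,weak}_{v}$ is the set of real sequences $x$ with $\sup_{\lambda>0}\lambda\,[v(\{k\in\mathbb{Z}:|x(k)|>\lambda\})]^{1/q}<\infty$, where $v(E)=\sum_{k\in E}v(k)$. *)

(* Defs.v *)
From HB Require Import structures.
From mathcomp Require Import all_boot all_order all_algebra.
From mathcomp Require Import all_classical all_reals all_analysis.

Set Implicit Arguments.
Unset Strict Implicit.
Unset Printing Implicit Defensive.

Import Order.TTheory GRing.Theory Num.Theory.

Local Open Scope classical_set_scope.
Local Open Scope ring_scope.

Definition symint (m : int) (N : nat) : set int :=
  [set k | `|k - m| <= N%:Z].

(* The cardinality of symint m N, as a natural number. *)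
Definition symint_card (N : nat) : nat := (2 * N + 1)%N.

Definition discrete_weight (R : realType) (w : int -> R) : Prop :=
  forall k, 0 < w k.

Definition muckenhoupt_A1 (R : realType) (q : R) (w : int -> R) : Prop :=
  (ereal_sup [set
     ((((symint_card mN.2)%:R^-1 *
        \sum_(k \in symint mN.1 mN.2) w k `^ q) `^ q^-1)%:E
      * ereal_sup [set ((w k)^-1)%:E | k in symint mN.1 mN.2])%E
   | mN in [set: int * nat]] < +oo)%E.

(* Extended-real valued: for a general x the supremum may be +oo. *)
Definition frac_maximal (R : realType) (alpha : R) (x : int -> R) (m : int) :
    \bar R :=
  ereal_sup [set
    (((symint_card N)%:R `^ (1 - alpha))^-1 *
       \sum_(k \in symint m N) `|x k|)%:E
  | N in [set: nat]].

Definition l1_norm (R : realType) (w : int -> R) (x : int -> R) : \bar R :=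
  (\esum_(k in [set: int]) (`|x k| * w k)%:E)%E.

Definition l1_space (R : realType) (w : int -> R) : set (int -> R) :=
  [set x | (l1_norm w x < +oo)%E].

Definition weight_measure (R : realType) (v : int -> R) (E : set int) :
    \bar R :=
  (\esum_(k in E) (v k)%:E)%E.

(* The inequality at every lambda > 0 also forces T x to be finite everywhere
   when v > 0, so T x is then a real sequence lying in weak l^q_v. *)
Definition bounded_l1_weak (R : realType) (q : R) (w v : int -> R)
    (T : (int -> R) -> int -> \bar R) : Prop :=
  exists2 C : R, 0 < C &
    forall x : int -> R, l1_space w x -> forall lambda : R, 0 < lambda ->
      (weight_measure v [set k | (lambda%:E < T x k)%E] `^ q^-1
        <= (C / lambda)%:E * l1_norm w x)%E.

(* Main.v *)
(* Let S(m,N) be the interval of center m and radius N. The class A(1,q) says that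
   w^q(S)^(1/q) <= K |S|^(1/q) w(k) for all k in an interval S. If M_alpha x(m) > lambda,
   multiplying this inequality on the doubled interval S(m,2N) by |x(k)| and summing
   over S(m,N) yields w^q(S(m,2N))^(1/q) <= (2K/lambda) sum_(S(m,N)) |x| w, and a Vitali
   selection sums these estimates over disjoint intervals. As the right-hand side a
   is at most T = (2K/lambda) ||x||, the bound a^q <= T^(q-1) a makes the estimate of
   w^q(S(m,2N)) linear in a, hence additive over disjoint intervals.
   Conversely, one tests the weak inequality on the Dirac mass at a point k of
   S(m,N), whose maximal function is at least (4N+1)^(-1/q) on S(m,N). *)
Require Import Defs.
From HB Require Import structures.
From mathcomp Require Import all_boot all_order all_algebra.
From mathcomp Require Import all_classical all_reals all_analysis.
From mathcomp Require Import zify ring lra.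

Set Implicit Arguments.
Unset Strict Implicit.
Unset Printing Implicit Defensive.

Import Order.TTheory GRing.Theory Num.Theory.

Local Open Scope classical_set_scope.
Local Open Scope ring_scope.

(** * Symmetric intervals of integers *)

Lemma finite_symint (m : int) (N : nat) : finite_set (symint m N).
Proof.
apply: (@sub_finite_set _ _
  ((fun i : nat => m - N%:Z + i%:Z) @` `I_(2 * N + 1))); last exact: finite_image.
move=> k; rewrite /symint /= => hk.
exists `|(k - m + N%:Z)%R|%N; rewrite /=; lia.
Qed.

Lemma symint_center (m : int) (N : nat) : symint m N m.
Proof. by rewrite /symint /= subrr normr0. Qed.

Lemma sub_symint (m : int) (M N : nat) : (M <= N)%N -> symint m M `<=` symint m N.
Proof. by move=> MN k; rewrite /symint /=; lia. Qed.

Lemma sub_symint2 (m k : int) (N : nat) :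
  symint m N k -> symint m N `<=` symint k (2 * N).
Proof. by rewrite /symint => mk l /=; move: mk => /=; lia. Qed.

(** * Weighted counting measures: monotonicity and additivity *)

Section weight_measure.
Variables (R : realType) (v : int -> R).
Hypothesis v_ge0 : forall k, 0 <= v k.

Lemma weight_measure_ge0 (A : set int) : (0 <= weight_measure v A)%E.
Proof. by apply: esum_ge0 => k _; rewrite lee_fin. Qed.

Lemma weight_measure_fsum (A : set int) : finite_set A ->
  weight_measure v A = (\sum_(k \in A) v k)%:E.
Proof.
move=> finA; rewrite /weight_measure esum_fset ?fsumEFin// => k _.
by rewrite lee_fin.
Qed.

Lemma le_weight_measure (A B : set int) : A `<=` B ->
  (weight_measure v A <= weight_measure v B)%E.
Proof.
move=> AB; apply: ereal_sup_le => _ [F [finF FA] <-]; exists F => //.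
by split=> // k /FA /AB.
Qed.

Lemma weight_measureU (A B : set int) : A `&` B `<=` set0 ->
  weight_measure v (A `|` B) = (weight_measure v A + weight_measure v B)%E.
Proof.
move=> AB; rewrite /weight_measure (esumID A); last by move=> k _; rewrite lee_fin.
congr (_ + _)%E; congr esum; apply/seteqP; split=> k /=.
- by case.
- by move=> Ak; split=> //; left.
- by move=> [[]].
- by move=> Bk; split; [right|move=> Ak; apply: (AB k)].
Qed.

Lemma weight_measureU_le (A B : set int) :
  (weight_measure v (A `|` B) <= weight_measure v A + weight_measure v B)%E.
Proof.
rewrite -[A `|` B](setDUK (@subsetUl _ A B)) weight_measureU.
  by rewrite leeD2l// le_weight_measure// => k [[]].
by move=> k [Ak [_]].
Qed.

End weight_measure.

(* Greedy Vitali selection: an interval of maximal radius, doubled, contains the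
   centers of all the intervals which meet it. *)
Lemma vitali_covering (R : realType) (v g : int -> R) (r : int -> nat) (F : seq int) :
  (forall k, 0 <= v k) -> (forall k, 0 <= g k) ->
  (forall m, m \in F -> (weight_measure v (symint m (2 * r m))
     <= weight_measure g (symint m (r m)))%E) ->
  (weight_measure v [set` F]
     <= weight_measure g (\bigcup_(m in [set` F]) symint m (r m)))%E.
Proof.
move=> v_ge0 g_ge0; have [n] := ubnP (size F); elim: n F => // n IH F sF vg.
have [->|F0] := eqVneq F [::].
  by rewrite set_nil /weight_measure esum_set0; exact: weight_measure_ge0.
have [m mF mmax] : exists2 m, m \in F & forall k, k \in F -> (r k <= r m)%N.
  have exP : exists i, has (fun m => r m == i) F.
    by case: F F0 {sF vg} => // a F _; exists (r a); rewrite /= eqxx.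
  have ubP i : has (fun m => r m == i) F -> (i <= \max_(m <- F) r m)%N.
    by move=> /hasP[m mF /eqP <-]; apply: leq_bigmax_seq.
  case: (ex_maxnP exP ubP) => i /hasP[m mF /eqP <-] imax; exists m => // k kF.
  by apply: imax; apply/hasP; exists k.
(* [F'] keeps the centers whose intervals are disjoint from that of [m]. It drops [m] itself, so the
   induction on the size applies. *)
pose F' := [seq k <- F | `|k - m| > (r k + r m)%N%:Z].
have F'F k : k \in F' -> k \in F by rewrite mem_filter => /andP[].
have sF' : (size F' < n)%N.
  rewrite -ltnS (leq_trans _ sF)// ltnS size_filter -count_predT ltn_neqAle.
  rewrite sub_count// andbT count_predT -all_count; apply/negP => /allP/(_ m mF).
  by rewrite subrr normr0; lia.
have /IH := sF' => /(_ (fun k kF' => vg k (F'F k kF'))) {}IH.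
have disj : symint m (r m) `&` \bigcup_(k in [set` F']) symint k (r k) `<=` set0.
  move=> l [ml [k /= + kl]].
  by rewrite mem_filter => /andP[]; move: ml kl; rewrite /symint /=; lia.
apply: (@le_trans _ _ (weight_measure v (symint m (2 * r m) `|` [set` F']))).
  apply: le_weight_measure => k /= kF.
  have [kF'|kF'] := boolP (k \in F'); [by right|left].
  (* A discarded [k] satisfies |k - m| <= r k + r m <= 2 r m, by maximality of [r m]. *)
  by move: kF' (mmax _ kF); rewrite mem_filter kF /symint /=; lia.
apply: (le_trans (weight_measureU_le v_ge0 _ _)).
apply: (le_trans (leeD (vg _ mF) IH)).
rewrite -weight_measureU//; apply: le_weight_measure => l [ml|[k kF' kl]].
  by exists m.
by exists k => //=; apply: F'F.
Qed.

(** * Sums over intervals and the pointwise form of A(1,q) *)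

Lemma ler_fsum (R : numDomainType) (I : choiceType) (A : set I) (f g : I -> R) :
  finite_set A -> (forall i, A i -> f i <= g i) ->
  \sum_(i \in A) f i <= \sum_(i \in A) g i.
Proof.
move=> finA fg; rewrite !fsbig_finite//= big_seq [leRHS]big_seq.
by apply: ler_sum => i; rewrite in_fset_set// inE => /fg.
Qed.

Lemma symint_card_gt0 (R : realType) (N : nat) : 0 < (symint_card N)%:R :> R.
Proof. by rewrite ltr0n /symint_card addn1. Qed.

(** Since 4N + 1 <= 2 (2N + 1), the ratio of the two powers is at most 2^s, and 2^s <= 2 because s
    <= 1. *)
Lemma symint_card_double (R : realType) (s : R) (N : nat) : 0 <= s <= 1 ->
  (symint_card (2 * N))%:R `^ s <= 2 * (symint_card N)%:R `^ s :> R.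
Proof.
move=> /andP[s0 s1].
have c2 : (symint_card (2 * N))%:R <= 2 * (symint_card N)%:R :> R.
  by rewrite -natrM ler_nat /symint_card; lia.
apply: (le_trans (ge0_ler_powR s0 _ _ c2)); rewrite ?nnegrE ?mulr_ge0//.
rewrite powRM// ler_wpM2r ?powR_ge0//.
by rewrite -[leRHS](@powRr1 _ 2)// ler_powR// ler1n.
Qed.

(** Bounding the supremum of 1 / w amounts to testing each point [k]; the factors 1 / |S|^(1/q) and
    1 / w(k) then move to the right-hand side. *)
Lemma muckenhoupt_A1P (R : realType) (q : R) (w : int -> R) :
  0 < q -> discrete_weight w ->
  muckenhoupt_A1 q w <->
  exists2 K : R, 0 < K & forall m N k, symint m N k ->
    (\sum_(l \in symint m N) w l `^ q) `^ q^-1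
      <= K * (symint_card N)%:R `^ q^-1 * w k.
Proof.
move=> q0 w0.
have V_gt0 m N : 0 < \sum_(l \in symint m N) w l `^ q.
  rewrite (fsbigD1 m)/=; [|exact: finite_symint|exact: symint_center].
  by rewrite ltr_pwDl ?powR_gt0//; apply: fsumr_ge0 => l _; rewrite powR_ge0.
have avg m N : ((symint_card N)%:R^-1 * \sum_(l \in symint m N) w l `^ q) `^ q^-1
    = (\sum_(l \in symint m N) w l `^ q) `^ q^-1 / (symint_card N)%:R `^ q^-1.
  rewrite powRM ?invr_ge0 ?ler0n ?(ltW (V_gt0 _ _))// mulrC; congr (_ * _).
  by rewrite -powR_inv1// -!powRrM mulrC powRrM powR_inv1 ?powR_ge0.
have c_gt0 N : 0 < (symint_card N)%:R `^ q^-1 :> R by rewrite powR_gt0// symint_card_gt0.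
split=> [|[K K0 HK]].
- rewrite /muckenhoupt_A1; set s : \bar R := ereal_sup _ => s_lty.
  have bound m N k : symint m N k ->
      ((((symint_card N)%:R^-1 * \sum_(l \in symint m N) w l `^ q) `^ q^-1
        * (w k)^-1)%:E <= s)%E.
    move=> mk; apply: (@le_trans _ _
      ((((symint_card N)%:R^-1 * \sum_(l \in symint m N) w l `^ q) `^ q^-1)%:E
      * ereal_sup [set ((w k)^-1)%:E | k in symint m N])%E).
      rewrite EFinM lee_wpmul2l ?lee_fin ?powR_ge0//.
      by apply: ereal_sup_ubound; exists k.
    by apply: ereal_sup_ubound; exists (m, N).
  have s_ge0 : (0 <= s)%E.
    apply: le_trans (bound 0 0%N 0 (symint_center _ _)).
    by rewrite lee_fin mulr_ge0 ?powR_ge0// invr_ge0 ltW.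
  have sE : s = (fine s)%:E by rewrite fineK// ge0_fin_numE.
  (* Adding 1 turns the nonnegative [fine s] into a positive constant. *)
  exists (fine s + 1); first by rewrite ltr_wpDl// fine_ge0.
  move=> m N k /bound; rewrite sE lee_fin avg => bnd.
  rewrite mulrAC -ler_pdivrMr// -ler_pdivrMr//.
  by apply: (le_trans bnd); rewrite lerDl.
- apply: (@le_lt_trans _ _ K%:E); last exact: ltry.
  apply: ge_ereal_sup => _ [[m N] _ <-] /=; rewrite avg.
  set a := _ / _; have a0 : 0 < a by rewrite divr_gt0// powR_gt0.
  (* Factoring out the average [a] leaves only the supremum of 1 / w to be bounded, by K / a. *)
  have -> : K%:E = (a%:E * (a^-1 * K)%:E)%E by rewrite -EFinM mulVKf ?gt_eqF.
  apply: lee_wpmul2l; first by rewrite lee_fin ltW.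
  apply: ge_ereal_sup => _ [k mk <-].
  rewrite lee_fin ler_pdivlMl// ler_pdivrMr// /a ler_pdivrMr// mulrAC.
  exact: HK.
Qed.

(** * From A(1,q) to the weak-type inequality *)

Lemma bounded_of_A1 (R : realType) (alpha q : R) (w : int -> R) :
  0 < alpha < 1 -> q^-1 = 1 - alpha -> discrete_weight w ->
  muckenhoupt_A1 q w ->
  bounded_l1_weak q w (fun k => w k `^ q) (frac_maximal alpha).
Proof.
move=> /andP[alpha0 alpha1] q_def w0.
have s01 : 0 <= q^-1 <= 1 by rewrite q_def; apply/andP; split; lra.
have q0 : 0 < q by rewrite -invr_gt0 q_def; lra.
have q1 : 1 <= q by rewrite -invf_le1// q_def; lra.
move=> /(muckenhoupt_A1P q0 w0)[K K0 HK].
(* The 2 is the cost of doubling the interval, as in [symint_card_double]. *)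
exists (2 * K); first by rewrite mulr_gt0.
move=> x xl lambda lambda0.
have w_ge0 k : 0 <= w k by rewrite ltW.
pose g k := `|x k| * w k.
have g_ge0 k : 0 <= g k by rewrite mulr_ge0.
pose v k := w k `^ q.
have v_ge0 k : 0 <= v k by rewrite powR_ge0.
have l1E : l1_norm w x = weight_measure g setT by [].
have [L L0 LE] : exists2 L : R, 0 <= L & l1_norm w x = L%:E.
  exists (fine (l1_norm w x)); first by rewrite fine_ge0// l1E weight_measure_ge0.
  by rewrite fineK// ge0_fin_numE// l1E weight_measure_ge0.
have gL A : finite_set A -> \sum_(k \in A) g k <= L.
  move=> finA; rewrite -lee_fin -LE l1E -weight_measure_fsum//.
  exact: le_weight_measure.
pose c := 2 * K / lambda.
have c0 : 0 < c by rewrite divr_gt0// mulr_gt0.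
have cL0 : 0 <= c * L by rewrite mulr_ge0// ltW.
rewrite LE -EFinM -/c -/v; set E := [set _ | _].
suff EcL : (weight_measure v E <= ((c * L) `^ q)%:E)%E.
  apply: (@le_trans _ _ (((c * L) `^ q)%:E `^ q^-1)%E).
    have [s0 _] := andP s01.
    by apply: gt0_ler_poweR; rewrite ?in_itv/= ?leey ?andbT ?lee_fin ?powR_ge0 ?weight_measure_ge0.
  by rewrite poweR_EFin -powRrM mulfV ?gt_eqF// powRr1.
(* A radius witnessing M_alpha x(m) > lambda at each point of [E]; the value 0 off [E] is a
   placeholder. *)
have [r rP] : {r : int -> nat & forall m, E m ->
    lambda < ((symint_card (r m))%:R `^ (1 - alpha))^-1 * \sum_(k \in symint m (r m)) `|x k|}.
  apply: (@choice _ _ (fun m N => E m ->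
    lambda < ((symint_card N)%:R `^ (1 - alpha))^-1 * \sum_(k \in symint m N) `|x k|)) => m.
  have [Em|nEm] := pselect (E m); last by exists 0%N.
  by have [_ [N _ <-]] := ereal_sup_gt Em; rewrite lte_fin => ?; exists N.
have ball m : E m -> \sum_(k \in symint m (2 * r m)) v k
    <= \sum_(k \in symint m (r m)) (c * L) `^ (q - 1) * c * g k.
  move=> /rP; set N := r m; rewrite -q_def => lt_lambda.
  set V := \sum_(k \in _) v k; rewrite -mulr_fsumr -mulrA.
  have V0 : 0 <= V by apply: fsumr_ge0.
  have gV : V `^ q^-1 <= c * \sum_(k \in symint m N) g k.
    rewrite /c mulrAC ler_pdivlMr// mulrC.
    have cN0 : 0 < (symint_card N)%:R `^ q^-1 :> R by rewrite powR_gt0// symint_card_gt0.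
    apply: (le_trans (ler_wpM2r (powR_ge0 _ _) (ltW lt_lambda))).
    rewrite -mulrA ler_pdivrMl// mulr_fsuml !mulr_fsumr; apply: ler_fsum.
      exact: finite_symint.
    move=> k mk; rewrite /g.
    (* A(1,q) is applied on S(m,2N); after doubling, |S(m,N)|^(1/q) cancels the normalization of the
       maximal function. *)
    have /HK/le_trans : symint m (2 * N) k by apply: sub_symint mk; exact: leq_pmull.
    move=> /(_ (K * (2 * (symint_card N)%:R `^ q^-1) * w k)) => Vk.
    have {}Vk := Vk (ler_wpM2r (w_ge0 k) (ler_wpM2l (ltW K0) (symint_card_double N s01))).
    apply: (le_trans (ler_wpM2l (normr_ge0 (x k)) Vk)).
    by rewrite le_eqVlt; apply/orP; left; apply/eqP; ring.
  have -> : V = (V `^ q^-1) `^ q by rewrite -powRrM mulVf ?gt_eqF// powRr1.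
  (* Of the q powers of V^(1/q), q - 1 are bounded by the global [c * L] and the last one by the
     local sum of [g]. *)
  rewrite -mulr_powRB1 ?powR_ge0// mulrC ler_pM ?powR_ge0//.
  apply: ge0_ler_powR; rewrite ?nnegrE ?powR_ge0 ?subr_ge0//.
  apply: (le_trans gV); rewrite ler_wpM2l ?gL ?ltW//.
  exact: finite_symint.
(* The measure of [E] is a supremum over finite subsets [A], each of which has an interval of
   largest radius. *)
apply: ge_ereal_sup => _ [A [finA AE] <-].
have C0 : 0 <= (c * L) `^ (q - 1) * c by rewrite mulr_ge0 ?powR_ge0// ltW.
have h_ge0 k : 0 <= (c * L) `^ (q - 1) * c * g k by rewrite mulr_ge0.
have AF : A = [set` finmap.enum_fset (fset_set A)].
  by apply/seteqP; split=> k /=; rewrite in_fset_set// inE.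
have finB : finite_set (\bigcup_(m in A) symint m (r m)).
  by apply: bigcup_finite => // m _; apply: finite_symint.
rewrite fsumEFin// -weight_measure_fsum//.
apply: (@le_trans _ _ (weight_measure (fun k => (c * L) `^ (q - 1) * c * g k)
    (\bigcup_(m in A) symint m (r m)))).
  rewrite AF; apply: vitali_covering => // m.
  rewrite in_fset_set// inE => Am; rewrite !weight_measure_fsum ?lee_fin//.
  - by apply: ball; apply: AE.
  - exact: finite_symint.
  - exact: finite_symint.
(* The sum of [g] over the finite union is at most L, and (c L)^(q - 1) c L = (c L)^q. *)
rewrite weight_measure_fsum// lee_fin -mulr_fsumr -(mulr_powRB1 cL0 q0).
by rewrite [leRHS]mulrC -mulrA ler_wpM2l ?powR_ge0// ler_wpM2l ?gL// ltW.
Qed.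

(** * From the weak-type inequality to A(1,q) *)

Lemma A1_of_bounded (R : realType) (alpha q : R) (w : int -> R) :
  0 < alpha < 1 -> q^-1 = 1 - alpha -> discrete_weight w ->
  bounded_l1_weak q w (fun k => w k `^ q) (frac_maximal alpha) ->
  muckenhoupt_A1 q w.
Proof.
move=> /andP[alpha0 alpha1] q_def w0 [C C0 HC].
have s01 : 0 <= q^-1 <= 1 by rewrite q_def; apply/andP; split; lra.
have q0 : 0 < q by rewrite -invr_gt0 q_def; lra.
(* One factor 2 comes from the halving in [lambda], the other from |S(m,2N)|^(1/q) <= 2
   |S(m,N)|^(1/q). *)
apply/(muckenhoupt_A1P q0 w0); exists (4 * C); first by rewrite mulr_gt0.
move=> m N k mk.
pose x (l : int) : R := (l == k)%:R.
have xE (f : int -> R) l : l != k -> `|x l| * f l = 0.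
  by rewrite /x => /negPf ->; rewrite normr0 mul0r.
have xk : `|x k| = 1 by rewrite /x eqxx normr1.
have xl1 : l1_norm w x = (w k)%:E.
  rewrite /l1_norm (esumID [set k]); last first.
    by move=> l _; rewrite lee_fin mulr_ge0// ltW.
  rewrite setTI esum_set1 ?xk ?mul1r ?lee_fin ?ltW//.
  by rewrite esum1 ?adde0// => l [_ /eqP lk]; rewrite xE.
have cN0 M : 0 < (symint_card M)%:R `^ q^-1 :> R by rewrite powR_gt0// symint_card_gt0.
(* Half the lower bound of the maximal function on S(m,N), since the level set [E] asks for a strict
   inequality. *)
set lambda := ((symint_card (2 * N))%:R `^ q^-1)^-1 / 2 : R.
have lambda0 : 0 < lambda by rewrite divr_gt0// invr_gt0.
have xw : l1_space w x by rewrite /l1_space/= xl1 ltry.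
have := HC x xw lambda lambda0; rewrite xl1 -EFinM.
set E := [set _ | _]; set V := \sum_(l \in _) _ => EC.
have v_ge0 l : 0 <= w l `^ q by rewrite powR_ge0.
have SE : symint m N `<=` E.
  move=> l ml; apply: (@lt_le_trans _ _
      (((symint_card (2 * N))%:R `^ q^-1)^-1 * 1)%:E).
    by rewrite lte_fin /lambda ltr_pM2l ?invr_gt0// invf_lt1// ltr1n.
  (* Radius 2N around [l] reaches [k], as both lie in S(m,N). *)
  apply: ereal_sup_ubound; exists (2 * N)%N => //; rewrite -q_def; congr (_ * _)%:E.
  rewrite -(@fsbig_widen _ _ _ _ [set k])/= ?fsbig_set1//.
    by move=> _ ->; apply: sub_symint2 mk.
  by move=> i [_ /eqP ik]; have := xE (cst 1) _ ik; rewrite mulr1.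
have V0 : 0 <= V by apply: fsumr_ge0.
have VC : V `^ q^-1 <= C / lambda * w k.
  rewrite -lee_fin -poweR_EFin; apply: le_trans EC; apply: gt0_ler_poweR.
  - by case/andP: s01.
  - by rewrite in_itv/= lee_fin V0 leey.
  - by rewrite in_itv/= weight_measure_ge0// leey.
  - by rewrite -weight_measure_fsum ?le_weight_measure//; apply: finite_symint.
apply: (le_trans VC); rewrite ler_wpM2r ?(ltW (w0 k))//.
rewrite /lambda invfM !invrK.
rewrite (_ : 4 * C * _ = C * (2 * (symint_card N)%:R `^ q^-1 * 2)); last by ring.
by rewrite ler_pM2l// ler_pM2r// symint_card_double.
Qed.

Theorem theorem3p2 (R : realType) (alpha q : R) (w : int -> R)
    (alpha_gt0 : 0 < alpha) (alpha_lt1 : alpha < 1)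
    (q_def : q^-1 = 1 - alpha) (w_weight : discrete_weight w) :
  muckenhoupt_A1 q w <->
  bounded_l1_weak q w (fun k => w k `^ q) (frac_maximal alpha).
Proof.
have alpha01 : 0 < alpha < 1 by rewrite alpha_gt0.
by split; [exact: bounded_of_A1|exact: A1_of_bounded].
Qed.
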